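(* Suppose $q \equiv 1 \pmod 8$ is a prime power. Then there is an $\epsilon$-secure strong circular $(q,4,(q-1)/4)$-AMD code with $$\epsilon < \frac{1}{4} + \frac{\sqrt{5}}{2}\, q^{-1/2}.$$
   Context: Let $\mathcal{G}$ be an additive abelian group of order $n$, let $A_0,\dots,A_{m-1}$ be $m$ pairwise disjoint $\ell$-subsets of $\mathcal{G}$, and let $0<\epsilon<1$. The family $(\mathcal{G},\{A_0,\dots,A_{m-1}\})$ is an $\epsilon$-secure strong circular $(n,m,\ell)$-AMD code if an adversary cannot win the following game with probability greater than $\epsilon$: (1) the source $i\in\{0,\dots,m-1\}$ is specified and given to the adversary; (2) the adversary chooses $\Delta\in\mathcal{G}\setminus\{0\}$; (3) $g$ is chosen uniformly at random from $A_i$; (4) the adversary wins if and only if $g+\Delta\in A_j$ where $j=i+1\bmod m$. That is, for every $i$ and every $\Delta\neq 0$, $|(A_i+\Delta)\cap A_{i+1\bmod m}|/\ell\leq\epsilon$. *)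

(* Defs.v *)
From HB Require Import structures.
From mathcomp Require Import all_boot all_order all_algebra.
From mathcomp Require Import reals.

Set Implicit Arguments.
Unset Strict Implicit.
Unset Printing Implicit Defensive.

Import Order.TTheory GRing.Theory Num.Theory.

Local Open Scope ring_scope.

Definition prime_power (q : nat) : Prop :=
  exists p k : nat, [/\ prime p, (0 < k)%N & q = (p ^ k)%N].

Section StrongCircularAMD.

Variables (R : realType) (G : finZmodType) (m : nat) (A : 'I_m -> {set G}).

(* Each g in A i is drawn with probability 1 / #|A i|; [ordS i] has value
   i.+1 %% m. *)
Definition win_prob (i : 'I_m) (Delta : G) : R :=
  \sum_(g in A i | g + Delta \in A (ordS i)) (#|A i|%:R)^-1.

(* The source i is given to the adversary, so the bound is required for every i
   and every choice of Delta. *)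
Definition strong_circular_AMD (n l : nat) (eps : R) : Prop :=
  [/\ 0 < eps < 1,
      #|G| = n,
      forall i, #|A i| = l,
      forall i j, i != j -> [disjoint A i & A j]
    & forall (i : 'I_m) (Delta : G), Delta != 0 -> win_prob i Delta <= eps].

Lemma win_probE (i : 'I_m) (Delta : G) :
  win_prob i Delta
  = #|[set g + Delta | g in A i] :&: A (ordS i)|%:R / #|A i|%:R.
Proof.
rewrite /win_prob sumr_const -[LHS]mulr_natl; congr (_%:R * _).
rewrite -(card_imset _ (addIr Delta)); apply: eq_card => x.
rewrite inE; apply/imsetP/andP => [[g /andP[gA gD] ->]|[/imsetP[g gA ->] gD]].
  by split=> //; apply: imset_f.
by exists g => //; apply/andP.
Qed.

End StrongCircularAMD.

(* Main.v *)
(** Let [C_0, .., C_3] be the cosets of the fourth powers in the multiplicative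
group of the field with [q = 4 f + 1] elements, [C_0] being the group of fourth
powers, and let [(a, b)] be the number
of solutions of [x + y = 1] with [x] in [C_a] and [y] in [C_b].  The adversary
wins with probability [(i - k, i + 1 - k) / f] when [Delta] lies in [C_k], so
only [B = (0, 1)], [D = (0, 3)] and [E = (1, 2)] matter.  As [-1] lies in [C_0]
([f] is even), the symmetries of [x + y = 1] leave five distinct numbers [(a, b)],
and counting each class gives three linear relations between them.  Counting in
two ways the solutions of [x + y = u + v] with [x], [y] in [C_0] and [u], [v] in
[C_1] gives a quadratic one; together they say that [s = (q + 1 - 16 E) / 2] and
[t = B - D] satisfy [s ^ 2 + 4 t ^ 2 = q].  The bound then follows from
[16 B = q - 3 + 2 s + 8 t], [16 D = q - 3 + 2 s - 8 t] and the Cauchy-Schwarz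
inequality [(s + 4 t) ^ 2 <= 5 (s ^ 2 + 4 t ^ 2)]; for [E] the estimate
[2 - s <= sqrt (5 q)] suffices. *)

Require Import Defs.
From HB Require Import structures.
From mathcomp Require Import all_boot all_order all_algebra.
From mathcomp Require Import all_solvable all_field.
From mathcomp Require Import reals.
From mathcomp Require Import zify ring lra.

Set Implicit Arguments.
Unset Strict Implicit.
Unset Printing Implicit Defensive.

Import Order.TTheory GRing.Theory Num.Theory.

Local Open Scope ring_scope.

(** The nonzero elements are [#|F|.-1] distinct roots of unity of that order, and so many roots must
    include a primitive one. *)
Lemma finField_prim_root (F : finFieldType) :
  exists g : F, #|F|.-1.-primitive_root g.
Proof.
have n_gt0 : (0 < #|F|.-1)%N by rewrite -subn1 subn_gt0 finNzRing_gt1.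
pose rs := enum (predC1 (0 : F)).
have /hasP[g _ gP] : has (#|F|.-1).-primitive_root rs.
  apply: has_prim_root => //; first 2 last.
  - by rewrite -cardE cardC1.
  - apply/allP => x; rewrite mem_enum unity_rootE => /= x0.
    apply/eqP/(mulfI x0).
    by rewrite mulr1 -exprS (ltn_predK (finNzRing_gt1 F)) expf_card.
  by rewrite enum_uniq.
by exists g.
Qed.

(** * Cosets of the fourth powers *)

Section QuarticClasses.

Variables (F : finFieldType) (f : nat) (z : F).
Hypotheses (f_gt0 : (0 < f)%N) (f_even : ~~ odd f) (cardF : #|F| = (4 * f).+1).
Hypothesis z_prim : 4.-primitive_root z.
Hypothesis z_pow : exists g : F, z = g ^+ f.

(* [z] generates the fourth roots of unity, so the class of [x] is read off
   [x ^+ f], the quartic character of [x]. *)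
Definition quartic_class (a : 'Z_4) : {set F} := [set x | x ^+ f == z ^+ a].

Local Notation C := quartic_class.

Lemma quartic_class_neq0 a x : x \in C a -> x != 0.
Proof.
rewrite inE; apply: contraTneq => ->; rewrite expr0n (gtn_eqF f_gt0).
rewrite eq_sym expf_neq0 //; apply/eqP => z0.
have := prim_expr_order z_prim.
by rewrite z0 expr0n => /eqP; rewrite eq_sym oner_eq0.
Qed.

Lemma prim4_exprD (a b : 'Z_4) : z ^+ (a + b)%R = z ^+ a * z ^+ b.
Proof. by rewrite -exprD -(prim_expr_mod z_prim (a + b)). Qed.

Lemma prim4_expr_inj (a b : 'Z_4) : (z ^+ a == z ^+ b) = (a == b).
Proof.
by rewrite (eq_prim_root_expr z_prim) !modn_small.
Qed.

Lemma quartic_classM a b x y : x \in C a -> y \in C b -> x * y \in C (a + b).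
Proof. by rewrite !inE exprMn prim4_exprD => /eqP-> /eqP->. Qed.

Lemma quartic_classN a x : (- x \in C a) = (x \in C a).
Proof. by rewrite !inE exprNn -signr_odd (negbTE f_even) mul1r. Qed.

Lemma quartic_class1 : 1 \in C 0.
Proof. by rewrite inE expr1n expr0. Qed.

Lemma quartic_class_inj a b x : x \in C a -> x \in C b -> a = b.
Proof.
by rewrite !inE => /eqP-> ab; apply/eqP; rewrite -prim4_expr_inj.
Qed.

Lemma quartic_classE a b x : x \in C a -> (x \in C b) = (a == b).
Proof.
move=> xa; apply/idP/eqP => [|<-//]; exact: quartic_class_inj xa.
Qed.

Lemma quartic_class_ex x : x != 0 -> exists a, x \in C a.
Proof.
move=> x0; have x4 : (x ^+ f) ^+ 4 = 1.
  by apply: (mulfI x0); rewrite mulr1 -exprM -exprS mulnC -cardF expf_card.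
by have [a xa] := prim_rootP z_prim x4; exists a; rewrite inE xa.
Qed.

Lemma quartic_classMr b x y a : y \in C b -> (x * y \in C a) = (x \in C (a - b)).
Proof.
move=> yb; have [->|/quartic_class_ex[c xc]] := eqVneq x 0.
  by rewrite mul0r; apply/idP/idP => /quartic_class_neq0; rewrite eqxx.
rewrite (quartic_classE _ xc) (quartic_classE _ (quartic_classM xc yb)).
by rewrite eq_sym -subr_eq eq_sym.
Qed.

Lemma sum_quartic_class x : (\sum_a (x \in C a) = (x != 0%R))%N.
Proof.
have [->|/quartic_class_ex[c xc]] := eqVneq x 0.
  rewrite big1 // => a _; apply/eqP; rewrite eqb0.
  by apply/negP => /quartic_class_neq0; rewrite eqxx.
rewrite (bigD1 c) //= xc big1 ?addn0 // => a ac.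
by rewrite (quartic_classE _ xc) eq_sym (negbTE ac).
Qed.

Lemma sum_over_quartic_classes (h : F -> nat) :
  (\sum_x h x = h 0%R + \sum_a \sum_(x in C a) h x)%N.
Proof.
rewrite (bigD1 0) //=; congr addn.
under [RHS]eq_bigr do rewrite big_mkcond /=.
rewrite exchange_big big_mkcond /=; apply: eq_bigr => x _.
transitivity (\sum_a (x \in C a) * h x)%N.
  by rewrite -big_distrl sum_quartic_class /=; case: eqP; rewrite ?mul1n.
by apply: eq_bigr => a _; case: (x \in C a); rewrite ?mul1n.
Qed.

Lemma quartic_class_generator : exists g, g \in C 1.
Proof. by case: z_pow => g zg; exists g; rewrite inE -zg expr1. Qed.

Lemma quartic_class_ne a : exists g, g \in C a.
Proof.
have [g g1] := quartic_class_generator.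
have gP n : g ^+ n \in C (n%:R).
  elim: n => [|n IHn]; first exact: quartic_class1.
  by rewrite exprS -natr1 addrC; apply: quartic_classM.
by exists (g ^+ a); have := gP a; rewrite natr_Zp.
Qed.

(** Multiplication by an element of [C b] carries [C 0] onto [C b], so the four classes share the
    [4 * f] nonzero elements equally. *)
Lemma card_quartic_class a : #|C a| = f.
Proof.
have eqC b : #|C b| = #|C 0|.
  have [g gb] := quartic_class_ne b.
  have g0 := quartic_class_neq0 gb.
  rewrite -(card_imset (C 0) (mulIf g0)); apply: eq_card => x.
  apply/idP/imsetP => [xb|[y y0 ->]]; last by rewrite -[b]add0r quartic_classM.
  exists (x / g); last by rewrite divfK.
  by rewrite -[X in C X](subrr b) -(quartic_classMr _ _ gb) divfK.
have := sum_over_quartic_classes (fun=> 1%N).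
rewrite sum1_card cardF; under eq_bigr do rewrite sum1_card eqC.
by rewrite sum_nat_const card_ord (eqC a) /Zp_trunc /=; clear f_even; lia.
Qed.

(** * Representations as sums of two classes, and cyclotomic numbers *)

Definition nb_rep (a b : 'Z_4) (d : F) : nat :=
  \sum_x (x \in C a) * ((d - x)%R \in C b).

(** The classical cyclotomic number counts [x] in [C a] with [x + 1] in [C b]; replacing [x] by
    [- x] shows that the two agree, [-1] being in [C 0]. *)
Definition cyclotomic_number (a b : 'Z_4) : nat := nb_rep a b 1.

Local Notation N := cyclotomic_number.

Lemma nb_rep0 a b : nb_rep a b 0 = ((a == b) * f)%N.
Proof.
rewrite /nb_rep; under eq_bigr do rewrite sub0r quartic_classN.
rewrite -(card_quartic_class a) -sum1_card big_distrr /= [RHS]big_mkcond /=.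
apply: eq_bigr => x _; case: ifP => // xa.
by rewrite (quartic_classE _ xa) mul1n muln1.
Qed.

(** Divide [x + y = d] by [d]. *)
Lemma nb_rep_class a b c d : d \in C c -> nb_rep a b d = N (a - c) (b - c).
Proof.
move=> dc; have d0 := quartic_class_neq0 dc.
rewrite /nb_rep (reindex_onto (fun x => x * d) (fun x => x / d)) /=; last first.
  by move=> x _; rewrite divfK.
apply: eq_big => x; first by rewrite mulfK // eqxx.
by move=> _; rewrite -{2}[d]mul1r -mulrBl !(quartic_classMr _ _ dc).
Qed.

Lemma cyclotomic_numberC a b : N a b = N b a.
Proof.
rewrite /N /nb_rep (reindex_inj (can_inj (subKr 1))) /=.
by apply: eq_bigr => x _; rewrite subKr mulnC.
Qed.

(* Divide [x + y = 1] by [x]. *)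
Lemma cyclotomic_number_div a b : N a b = N (- a) (b - a).
Proof.
rewrite /N /nb_rep (reindex_inj invr_inj) /=.
apply: eq_bigr => x _.
have [->|x0] := eqVneq x 0.
  rewrite invr0.
  case: (boolP (0 \in C a)) => [/quartic_class_neq0|_];
    rewrite ?eqxx //.
  by case: (boolP (0 \in C (- a))) => [/quartic_class_neq0|_]; rewrite ?eqxx.
have -> : (x^-1 \in C a) = (x \in C (- a)).
  have [c xc] := quartic_class_ex x0.
  rewrite (quartic_classE _ xc) -[a in LHS](addrK c) -(quartic_classMr _ _ xc).
  rewrite mulVf // (quartic_classE _ quartic_class1).
  by rewrite eq_sym addrC addr_eq0.
case: (boolP (x \in C (- a))) => // xa; rewrite !mul1n.
rewrite -{1}[b](addrK (- a)) -(quartic_classMr _ _ xa).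
by rewrite mulrBl mul1r mulVf // -quartic_classN opprB.
Qed.

(** Every [x] in [C a] is counted once, by the class of [1 - x], except [x = 1], which lies in
    [C 0]. *)
Lemma cyclotomic_number_row a : (\sum_b N a b + (a == 0%R) = f)%N.
Proof.
rewrite exchange_big /= -[RHS](card_quartic_class a) -sum1_card [RHS]big_mkcond /=.
under eq_bigr do rewrite -big_distrr sum_quartic_class subr_eq0 /=.
rewrite (bigD1 1) //= [RHS](bigD1 1) //= eqxx muln0 add0n.
rewrite (quartic_classE _ quartic_class1) addnC eq_sym; congr addn.
by apply: eq_bigr => x x1; rewrite eq_sym x1 muln1; case: (x \in _).
Qed.

(* Both sides count the solutions of [x + y = u + v] with [x], [y], [u], [v] in
   the classes [a], [b], [c], [e]. *)
Lemma nb_rep_exchange a b c e :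
  (\sum_d nb_rep a b d * nb_rep c e d = \sum_d nb_rep a c d * nb_rep e b d)%N.
Proof.
pose T x y u v := ((x \in C a) * (y \in C b) * ((u \in C c) * (v \in C e)))%N.
transitivity (\sum_x \sum_u \sum_d T x (d - x)%R u (d - u)%R)%N.
  under eq_bigr do rewrite big_distrl /=.
  rewrite exchange_big; apply: eq_bigr => x _ /=.
  under eq_bigr do rewrite big_distrr /=.
  by rewrite exchange_big.
under [RHS]eq_bigr do rewrite big_distrl /=.
rewrite [RHS]exchange_big; apply: eq_bigr => x _ /=.
(* The equation is rewritten as [x - u = v - y], whose common value is the variable [d] of the
   right-hand sum; the signs do not change the classes. *)
rewrite [RHS](reindex_inj (can_inj (subKr x))) /=; apply: eq_bigr => u _.
rewrite big_distrr [RHS](reindex_inj (addIr (- u))) /=; apply: eq_bigr => d _.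
have -> : x - u - x = - u by rewrite addrAC subrr sub0r.
rewrite quartic_classN /T -(quartic_classN b (d - x)) opprB.
have -> : x - u - (d - u) = x - d by ring.
by rewrite -!mulnA; congr muln; rewrite mulnCA; congr muln; rewrite mulnC.
Qed.

(** The first term comes from [d = 0]; on each of the four classes, of size [f], the summand is
    constant. *)
Lemma sum_nb_rep_pair a b c e :
  (\sum_d nb_rep a b d * nb_rep c e d
   = (a == b) * f * ((c == e) * f)
     + f * \sum_k N (a - k)%R (b - k)%R * N (c - k)%R (e - k)%R)%N.
Proof.
rewrite sum_over_quartic_classes !nb_rep0 big_distrr /=; congr addn.
apply: eq_bigr => k _; rewrite -(card_quartic_class k) -sum_nat_const.
by apply: eq_bigr => d dk; rewrite !(nb_rep_class _ _ dk).
Qed.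

(** * Relations between the cyclotomic numbers of order four *)

Lemma sum_Z4 (h : 'Z_4 -> nat) :
  (\sum_k h k = h 0%R + h 1%R + h 2%:R%R + h 3%:R%R)%N.
Proof.
rewrite !(big_ord_recl, big_ord0) addn0 !addnA.
by congr (h _ + h _ + h _ + h _)%N; apply: val_inj.
Qed.

Lemma cyclotomic_number_relations :
  let A := N 0 0 in let B := N 0 1 in let C := N 0 2%:R in let D := N 0 3%:R in
  let E := N 1 2%:R in
  [/\ A + B + C + D + 1 = f, B + D + 2 * E = f, 2 * C + 2 * E = f
    & A * D + D * C + C * B + B * A + f = B ^ 2 + D ^ 2 + 2 * E ^ 2]%N.
Proof.
move=> A B C D E.
have Z4E : (- 0 = 0 :> 'Z_4) * (- 1 = 3%:R :> 'Z_4) * (- 2%:R = 2%:R :> 'Z_4)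
    * (- 3%:R = 1 :> 'Z_4) * (1 - 2%:R = 3%:R :> 'Z_4) * (2%:R - 1 = 1 :> 'Z_4)
    * (3%:R - 1 = 2%:R :> 'Z_4) * (3%:R - 2%:R = 1 :> 'Z_4)
    * (1 - 3%:R = 2%:R :> 'Z_4) * (2%:R - 3%:R = 3%:R :> 'Z_4).
  by do !split; apply: val_inj.
have N10 : N 1 0 = B by rewrite cyclotomic_numberC.
have N20 : N 2%:R 0 = C by rewrite cyclotomic_numberC.
have N30 : N 3%:R 0 = D by rewrite cyclotomic_numberC.
have N11 : N 1 1 = D by rewrite cyclotomic_number_div subrr !Z4E N30.
have N22 : N 2%:R 2%:R = C by rewrite cyclotomic_number_div subrr !Z4E N20.
have N33 : N 3%:R 3%:R = B by rewrite cyclotomic_number_div subrr !Z4E N10.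
have N21 : N 2%:R 1 = E by rewrite cyclotomic_numberC.
have N31 : N 3%:R 1 = E by rewrite cyclotomic_number_div !Z4E.
have N13 : N 1 3%:R = E by rewrite cyclotomic_numberC.
have N32 : N 3%:R 2%:R = E by rewrite -N13 [RHS]cyclotomic_number_div !Z4E.
have N23 : N 2%:R 3%:R = E by rewrite cyclotomic_number_div !Z4E.
split.
- by rewrite -(cyclotomic_number_row 0) sum_Z4 eqxx.
- by rewrite -(cyclotomic_number_row 1) sum_Z4 N10 N11 N13 -/E /=; lia.
- by rewrite -(cyclotomic_number_row 2%:R) sum_Z4 N20 N21 N22 N23 /=; lia.
(* Here [d = 0] contributes [f ^ 2] on the left and nothing on the right; division by [f] leaves the
   summand [f] of the quadratic relation. *)
have := nb_rep_exchange 0 0 1 1.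
rewrite !sum_nb_rep_pair !sum_Z4 !subr0 !sub0r !subrr !Z4E.
rewrite N10 N11 N22 N23 N30 N33 N21 N32 -/A -/B -/C -/D -/E.
rewrite !eqxx /= => fE.
by apply/eqP; rewrite -(eqn_pmul2l f_gt0); apply/eqP; move: fE; nia.
Qed.

(** Only [i - k] matters; its four values give [N 0 1], [N 1 2], [N 2 3] and [N 3 0], and the
    symmetries identify the third with the second. *)
Lemma cyclotomic_number_succ i k :
  [\/ N (i - k) (i + 1 - k) = N 0 1, N (i - k) (i + 1 - k) = N 0 3%:R
    | N (i - k) (i + 1 - k) = N 1 2%:R].
Proof.
rewrite addrAC; move: (i - k) => {i k}[[|[|[|[|//]]]] lt4].
- by apply: Or31; congr N; apply: val_inj.
- by apply: Or33; congr N; apply: val_inj.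
- apply: Or33; rewrite [RHS]cyclotomic_numberC [RHS]cyclotomic_number_div.
  by congr N; apply: val_inj.
- by apply: Or32; rewrite cyclotomic_numberC; congr N; apply: val_inj.
Qed.

(** An element [y = x + d] of the intersection amounts to the representation [d = y + (- x)], with
    [- x] again in [C i]. *)
Lemma card_quartic_translate i k d : d \in C k ->
  #|[set x + d | x in C i] :&: C (i + 1)| = N (i - k) (i + 1 - k).
Proof.
move=> dk; rewrite -(nb_rep_class _ _ dk) /nb_rep (reindex_inj oppr_inj) /=.
rewrite (reindex_inj (addIr (- d))) /= -sum1_card big_mkcond /=.
apply: eq_bigr => x _; rewrite quartic_classN opprK (addrC d) subrK inE.
have -> : (x \in [set y + d | y in C i]) = (x - d \in C i).
  apply/imsetP/idP => [[y yi ->]|xi]; first by rewrite addrK.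
  by exists (x - d); rewrite ?subrK.
by do 2!case: (_ \in _).
Qed.

End QuarticClasses.

(** * The real estimate *)

Lemma quartic_bound (R : rcfType) (f A B C D E n : nat) :
    (2 <= f)%N ->
    [/\ A + B + C + D + 1 = f, B + D + 2 * E = f, 2 * C + 2 * E = f
      & A * D + D * C + C * B + B * A + f = B ^ 2 + D ^ 2 + 2 * E ^ 2]%N ->
    [\/ n = B, n = D | n = E] ->
  n%:R / f%:R < 1 / 4 + Num.sqrt 5 / 2 * (Num.sqrt (4 * f).+1%:R)^-1 :> R.
Proof.
move=> f2 [/(congr1 (fun n => n%:R : R)) r0 /(congr1 (fun n => n%:R : R)) r1].
move=> /(congr1 (fun n => n%:R : R)) r2 /(congr1 (fun n => n%:R : R)) r3 nE.
have {nE} : [\/ n%:R = B%:R :> R, n%:R = D%:R :> R | n%:R = E%:R :> R].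
  by case: nE => ->; [apply: Or31|apply: Or32|apply: Or33].
move: r0 r1 r2 r3; rewrite -(addn1 (4 * f)) !(natrD, natrM, natrX).
have: 2%:R <= f%:R :> R by rewrite ler_nat.
move: (A%:R) (B%:R) (C%:R) (D%:R) (E%:R) (n%:R) (f%:R).
clear=> A B C D E n f f2 r0 r1 r2 r3 nE.
set q := 4 * f + 1.
have q9 : 9 <= q by rewrite /q; lra.
set s := Num.sqrt (5 : R); set r := Num.sqrt _.
have s2 : s ^+ 2 = 5 by rewrite sqr_sqrtr.
have r2' : r ^+ 2 = q by rewrite sqr_sqrtr; lra.
have r0' : 3 <= r by rewrite -(@ler_pXn2r _ 2) ?nnegrE ?sqrtr_ge0 ?r2' //; lra.
pose x := (q + 1 - 16 * E) / 2.
pose t := B - D.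
have xt : x ^+ 2 + 4 * t ^+ 2 = q.
  have eC : C = f / 2 - E by lra.
  have eA : A = f - 1 - B - C - D by lra.
  by move: r3; rewrite eA eC /x /t /q -r1; lra.
have sr0 : 0 <= s * r by rewrite mulr_ge0 ?sqrtr_ge0.
have le_sr y : y ^+ 2 <= 5 * q -> y <= s * r.
  move=> y2; have [y0|/ltW y0] := leP 0 y; last exact: le_trans sr0.
  by rewrite -(@ler_pXn2r _ 2) ?nnegrE // exprMn s2 r2'.
have eB : 16 * B = q - 3 + 2 * x + 8 * t by rewrite /x /t /q -r1; lra.
have eD : 16 * D = q - 3 + 2 * x - 8 * t by rewrite /x /t /q -r1; lra.
have eE : 16 * E = q + 1 - 2 * x by rewrite /x; lra.
clearbody x t.
have n_le : 16 * n <= q - 3 + 2 * (s * r).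
  have le1 : x + 4 * t <= s * r.
    by apply: le_sr; have := sqr_ge0 (x - t); lra.
  have le2 : x - 4 * t <= s * r.
    by apply: le_sr; have := sqr_ge0 (x + t); lra.
  have le3 : 2 - x <= s * r.
    (* [(2 - x) ^ 2 <= 8 + 2 * x ^ 2 <= 8 + 2 * q <= 5 * q]. *)
    by apply: le_sr; have := sqr_ge0 (2 + x); have := sqr_ge0 t; lra.
  by case: nE => ->; rewrite ?eB ?eD ?eE; lra.
have r_neq0 : r != 0 by apply/eqP; lra.
(* Multiplied by [16 * f = 4 * (q - 1)], the goal becomes [16 * n < q - 1 + 2 * (q - 1) * v]. Its
   right side exceeds the bound in [n_le] by [2 * (1 - v)], so [v < 1] gives strictness. *)
pose v := s / r.
have lt_sr : s < r.
  by rewrite -(@ltr_pXn2r _ 2) ?nnegrE ?sqrtr_ge0 ?s2 ?r2' //; lra.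
have r_gt0 : 0 < r by lra.
have v1 : v < 1 by rewrite ltr_pdivrMr ?mul1r.
have srE : s * r = v * q by rewrite -r2' /v; field.
have -> : s / 2 / r = v / 2 by rewrite /v; field.
by rewrite ltr_pdivrMr; [move: n_le; rewrite srE /q; lra | lra].
Qed.

Theorem theorem3p5 (R : realType) (q : nat)
    (hq : prime_power q) (hq8 : (q = 1 %[mod 8])%N) :
  exists (G : finZmodType) (A : 'I_4 -> {set G}) (eps : R),
    strong_circular_AMD A q ((q - 1) %/ 4)%N eps /\
    eps < 1 / 4 + Num.sqrt 5 / 2 * (Num.sqrt q%:R)^-1.
Proof.
have [p [k [p_pr k_gt0 qE]]] := hq.
have [F _ cardF] := PrimePowerField p_pr k_gt0.
rewrite -qE in cardF.
have q_gt1 : (1 < q)%N by rewrite -cardF finNzRing_gt1.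
pose f := ((q - 1) %/ 4)%N.
have qf : q = (4 * f).+1 by rewrite /f; lia.
have f2 : (2 <= f)%N by rewrite /f; lia.
(* The congruence modulo 8 enters here: it makes [-1] a fourth power. *)
have f_even : ~~ odd f by rewrite /f; lia.
have f_gt0 : (0 < f)%N by lia.
have cF : #|F| = (4 * f).+1 by rewrite cardF.
have [g g_prim] := finField_prim_root F.
have z_prim : 4.-primitive_root (g ^+ f).
  have := dvdn_prim_root g_prim (m := 4).
  by rewrite cF /= mulKn // => -> //; apply: dvdn_mulr.
have z_pow : exists g0 : F, g ^+ f = g0 ^+ f by exists g.
pose C := quartic_class f (g ^+ f).
pose N := cyclotomic_number f (g ^+ f).
have rels := cyclotomic_number_relations f_gt0 f_even cF z_prim z_pow.
pose B := N 0 1; pose D := N 0 3%:R; pose E := N 1 2%:R.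
pose m := maxn B (maxn D E).
(* [m / f] bounds every winning probability; the maximum with [1 / 4] makes [eps] positive and stays
   below the required bound. *)
exists F, C, (Num.max (1 / 4) (m%:R / f%:R)).
have eps_lt : Num.max (1 / 4) (m%:R / f%:R)
    < 1 / 4 + Num.sqrt 5 / 2 * (Num.sqrt q%:R)^-1 :> R.
  rewrite gt_max; apply/andP; split.
    by rewrite ltrDl mulr_gt0 ?divr_gt0 ?invr_gt0 ?sqrtr_gt0 // ltr0n qf.
  rewrite qf; apply: (quartic_bound _ f2 rels).
  rewrite /m; case: (leqP D E) => _; [case: (leqP B E)|case: (leqP B D)] => _.
  - exact: Or33.
  - exact: Or31.
  - exact: Or32.
  - exact: Or31.
have bound_lt1 : 1 / 4 + Num.sqrt 5 / 2 * (Num.sqrt q%:R)^-1 < 1 :> R.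
  have sq_gt0 : 0 < Num.sqrt q%:R :> R by rewrite sqrtr_gt0 ltr0n qf.
  have : Num.sqrt 5 / Num.sqrt q%:R < 1 :> R.
    rewrite ltr_pdivrMr // mul1r ltr_sqrt ?ltr0n ?qf // ltr_nat; lia.
  rewrite mulrAC; lra.
split=> //; split.
- by rewrite lt_max (lt_trans eps_lt) // andbT divr_gt0.
- exact: cardF.
- by move=> i; rewrite (card_quartic_class f_gt0 cF z_prim z_pow).
- move=> i j; apply: contraNT => /pred0Pn[x /andP[/= xi xj]].
  exact/eqP/(quartic_class_inj z_prim xi xj).
move=> i d d0; rewrite win_probE (card_quartic_class f_gt0 cF z_prim z_pow).
have [c dc] := quartic_class_ex cF z_prim d0.
(* The cyclic successor of a source is addition of 1 in the group indexing the classes. *)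
have -> : ordS i = (i : 'Z_4) + 1 by apply: val_inj; rewrite /= addn1.
rewrite (card_quartic_translate f_gt0 f_even cF z_prim _ dc) -/N le_max.
apply/orP; right; rewrite ler_pM2r ?invr_gt0 ?ltr0n // ler_nat /m.
by case: (cyclotomic_number_succ f_gt0 f_even cF z_prim i c);
  rewrite -/N => ->; rewrite !leq_max leqnn ?orbT.
Qed.
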